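(* Let $R$ be a commutative ring and let $A=\bigoplus_{n\ge0}A_n$ be a graded $R$-algebra with $A_0=R$. If $A$ is of finite presentation over $R$, then there exists $t>0$ such that $A$ is a $t$-pgg-$R$-algebra.
   Context: All rings are commutative. $\mathrm{gAlg}(R)$ is the category of $\mathbb{Z}_{\ge0}$-graded $R$-algebras whose degree zero part is $R$. A partial $R$-algebra with support $I\subseteq\mathbb{Z}_{\ge0}$, $0\in I$, consists of $R$-modules $A_i$ ($i\in I$), with $A_0=R$, and $R$-bilinear maps $m_{ij}:A_i\times A_j\to A_{i+j}$ for $i,j,i+j\in I$ that are commutative and associative wherever defined. A morphism of partial algebras $\{A_i\}_{i\in I}\to\{B_j\}_{j\in J}$ is a family of $R$-linear maps $f_i:A_i\to B_i$ ($i\in I\cap J$), equal to the identity of $R$ in degree $0$, with $f_{i+j}\circ m^A_{ij}=m^B_{ij}\circ(f_i,f_j)$ whenever $i,j,i+j\in I\cap J$; $\mathrm{pAlg}(R)$ is the resulting category. A graded algebra is a partial algebra, and $\bigoplus_{i=0}^tA_i$ is a partial algebra with support $\{0,\dots,t\}$ for every graded algebra $A$. A graded $R$-algebra $A$ with $A_0=R$ is a $t$-partially generated graded algebra ($t$-pgg-algebra, $t\ge1$) if for all $B\in\mathrm{gAlg}(R)$ the restriction map $\mathrm{Hom}_{\mathrm{gAlg}(R)}(A,B)\to\mathrm{Hom}_{\mathrm{pAlg}(R)}(\bigoplus_{i=0}^tA_i,B)$, $f\mapsto(f|_{A_i})_{0\le i\le t}$, is bijective. *)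

(* Defs.v *)
From HB Require Import structures.
From mathcomp Require Import all_boot all_algebra.
From mathcomp Require Import finmap.
From mathcomp.multinomials Require Import monalg.

Set Implicit Arguments.
Unset Strict Implicit.
Unset Printing Implicit Defensive.

Import GRing.Theory.

Local Open Scope ring_scope.

(* Rings are [comPzRingType]s, so that the zero ring is allowed both as base  *)
(* ring and as algebra.  The algebras of MathComp ([comAlgType R]) and the    *)
(* polynomial rings [{mpoly R[n]}], [{malg R[K]}] of multinomials all require *)
(* 1 != 0.  Hence an R-algebra is given here by its structure morphism        *)
(* {rmorphism R -> S}, and the ring structure of R[X_1, ..., X_n] is put on   *)
(* the additive group {malg R[K]} of finitely supported functions K -> R,     *)
(* with K the monoid of monomials.                                            *)

Definition monoid_alg (K : conomType) (R : comPzRingType) : Type :=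
  {malg R[K]}.

HB.instance Definition _ (K : conomType) (R : comPzRingType) :=
  GRing.Zmodule.on (monoid_alg K R).

Section MonoidAlgebra.
Variables (K : conomType) (R : comPzRingType).

Local Notation P := {malg R[K]}.
Implicit Types (f g h : P) (k l : K).

Definition monoid_alg_mul f g : P :=
  \sum_(k <- msupp f) \sum_(l <- msupp g) << f@_k * g@_l *g mmul k l >>.

Definition monoid_alg_one : P := << 1 *g @mone K >>.

Lemma monoid_alg_mulw (d1 d2 : {fset K}) f g :
  (msupp f `<=` d1)%fset -> (msupp g `<=` d2)%fset ->
  monoid_alg_mul f g =
  \sum_(k <- d1) \sum_(l <- d2) << f@_k * g@_l *g mmul k l >>.
Proof.
move=> le_d1 le_d2; rewrite /monoid_alg_mul (big_fset_incl _ le_d1) /=.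
  apply/eq_bigr=> k _; apply/big_fset_incl => // l _ /mcoeff_outdom ->.
  by rewrite mulr0 monalgU0.
move=> k _ /mcoeff_outdom fk.
by rewrite big1 // => l _; rewrite fk mul0r monalgU0.
Qed.

Lemma monoid_alg_mulC : commutative monoid_alg_mul.
Proof.
move=> f g; rewrite /monoid_alg_mul exchange_big.
by apply/eq_bigr=> l _; apply/eq_bigr=> k _; rewrite mulrC mulmC.
Qed.

Lemma monoid_alg_mulUU (a b : R) k l :
  monoid_alg_mul << a *g k >> << b *g l >> = << a * b *g mmul k l >>.
Proof.
by rewrite (monoid_alg_mulw msuppU_le msuppU_le) !big_seq_fset1 !mcoeffUU.
Qed.

Lemma monoid_alg_mul1 : left_id monoid_alg_one monoid_alg_mul.
Proof.
move=> g; rewrite (monoid_alg_mulw msuppU_le (fsubset_refl _)) big_seq_fset1.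
by rewrite [RHS]monalgE; apply/eq_bigr=> k _; rewrite mcoeffUU mul1r mul1m.
Qed.

Lemma monoid_alg_mulDl : left_distributive monoid_alg_mul +%R.
Proof.
move=> f g h.
rewrite (monoid_alg_mulw (msuppD_le f g) (fsubset_refl _)).
rewrite (monoid_alg_mulw (fsubsetUl _ (msupp g)) (fsubset_refl (msupp h))).
rewrite (monoid_alg_mulw (fsubsetUr (msupp f) _) (fsubset_refl (msupp h))).
rewrite -big_split; apply/eq_bigr=> k _ /=.
rewrite -big_split; apply/eq_bigr=> l _ /=.
by rewrite mcoeffD mulrDl monalgUD.
Qed.

Lemma monoid_alg_mulDr : right_distributive monoid_alg_mul +%R.
Proof.
by move=> f g h; rewrite monoid_alg_mulC monoid_alg_mulDl !(monoid_alg_mulC f).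
Qed.

Lemma monoid_alg_mul0 : left_zero 0 monoid_alg_mul.
Proof. by move=> g; rewrite /monoid_alg_mul msupp0 big_seq_fset0. Qed.

Lemma monoid_alg_mulr0 : right_zero 0 monoid_alg_mul.
Proof. by move=> g; rewrite monoid_alg_mulC monoid_alg_mul0. Qed.

Lemma monoid_alg_suml I (r : seq I) (F : I -> P) g :
  monoid_alg_mul (\sum_(i <- r) F i) g = \sum_(i <- r) monoid_alg_mul (F i) g.
Proof.
exact: (big_morph (monoid_alg_mul^~ g)
  (fun _ _ => monoid_alg_mulDl _ _ _) (monoid_alg_mul0 g)).
Qed.

Lemma monoid_alg_sumr I (r : seq I) (F : I -> P) g :
  monoid_alg_mul g (\sum_(i <- r) F i) = \sum_(i <- r) monoid_alg_mul g (F i).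
Proof.
exact: (big_morph (monoid_alg_mul g)
  (fun _ _ => monoid_alg_mulDr _ _ _) (monoid_alg_mulr0 g)).
Qed.

Lemma monoid_alg_mulA : associative monoid_alg_mul.
Proof.
move=> f g h; rewrite (monalgE f) !monoid_alg_suml.
apply/eq_bigr=> k _; rewrite (monalgE g) monoid_alg_sumr !monoid_alg_suml.
rewrite monoid_alg_sumr; apply/eq_bigr=> l _.
rewrite (monalgE h) !monoid_alg_sumr; apply/eq_bigr=> m _.
by rewrite !monoid_alg_mulUU mulrA mulmA.
Qed.

End MonoidAlgebra.

HB.instance Definition _ (K : conomType) (R : comPzRingType) :=
  GRing.Zmodule_isComPzRing.Build (monoid_alg K R)
    (@monoid_alg_mulA K R) (@monoid_alg_mulC K R)
    (@monoid_alg_mul1 K R) (@monoid_alg_mulDl K R).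

Notation polyring R n := (monoid_alg {cmonom 'I_n} R).

Definition polyring_const (R : comPzRingType) (n : nat) (c : R) :
  polyring R n := << c *g mone >>.

(* S ~ R[X_1, ..., X_n] / (f_1, ..., f_m) as R-algebras *)
Definition finitely_presented (R S : comPzRingType)
    (alpha : {rmorphism R -> S}) : Prop :=
  exists (n m : nat) (f : 'I_m -> polyring R n)
         (phi : {rmorphism polyring R n -> S}),
    [/\ forall c : R, phi (polyring_const n c) = alpha c,
        forall x : S, exists p : polyring R n, phi p = x
      & forall p : polyring R n, phi p = 0 <->
          exists g : 'I_m -> polyring R n, p = \sum_(j < m) g j * f j].

(* The objects of gAlg(R): the grading is internal, [gpiece A n] is the       *)
(* subset A_n, and A_0 = R is the statement that the structure morphism is an *)
(* isomorphism of R onto A_0.                                                 *)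
Record gradedAlg (R : comPzRingType) := GradedAlg {
  gcarrier :> comPzRingType;
  gstruct : {rmorphism R -> gcarrier};
  gpiece : nat -> {pred gcarrier};
  gpiece_zmod : forall n, zmod_closed (gpiece n);
  gpiece_mul : forall m n x y,
    x \in gpiece m -> y \in gpiece n -> x * y \in gpiece (m + n)%N;
  gpiece_span : forall x, exists (N : nat) (c : nat -> gcarrier),
    (forall n, c n \in gpiece n) /\ x = \sum_(n < N) c n;
  gpiece_direct : forall (N : nat) (c : nat -> gcarrier),
    (forall n, c n \in gpiece n) -> \sum_(n < N) c n = 0 ->
    forall n, (n < N)%N -> c n = 0;
  gstruct_inj : injective gstruct;
  gpiece0P : forall x, x \in gpiece 0%N <-> exists r, x = gstruct r
}.

Arguments gpiece {R} A n : rename.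
Arguments gpiece_zmod {R} A n : rename.
Arguments gpiece_mul {R} A {m n x y} _ _ : rename.
Arguments gstruct_inj {R} A : rename.
Arguments gpiece0P {R} A x : rename.

Record gradedHom (R : comPzRingType) (A B : gradedAlg R) := GradedHom {
  ghom :> {rmorphism A -> B};
  ghom_struct : forall r, ghom (gstruct A r) = gstruct B r;
  ghom_piece : forall n x, x \in gpiece A n -> ghom x \in gpiece B n
}.

Section Homogeneous.
Variables (R : comPzRingType) (A : gradedAlg R).

HB.instance Definition _ (n : nat) :=
  GRing.isZmodClosed.Build A (gpiece A n) (gpiece_zmod A n).

Record homog (n : nat) := Homog {
  homog_val : A;
  homogP : homog_val \in gpiece A n
}.

HB.instance Definition _ n := [isSub for @homog_val n].
HB.instance Definition _ n := [Choice of homog n by <:].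
HB.instance Definition _ n := [SubChoice_isSubZmodule of homog n by <:].

Lemma gpiece_struct r : gstruct A r \in gpiece A 0%N.
Proof. by apply/gpiece0P; exists r. Qed.

Definition homog_scale n (r : R) (x : homog n) : homog n :=
  Homog (gpiece_mul A (gpiece_struct r) (homogP x)).

Fact homog_scaleA n a b (x : homog n) :
  homog_scale a (homog_scale b x) = homog_scale (a * b) x.
Proof. by apply: val_inj; rewrite /= rmorphM mulrA. Qed.

Fact homog_scale1 n : left_id 1 (@homog_scale n).
Proof. by move=> x; apply: val_inj; rewrite /= rmorph1 mul1r. Qed.

Fact homog_scaleDr n : right_distributive (@homog_scale n) +%R.
Proof. by move=> a x y; apply: val_inj; rewrite /= mulrDr. Qed.

Fact homog_scaleDl n (x : homog n) :
  {morph (@homog_scale n)^~ x : a b / a + b}.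
Proof. by move=> a b; apply: val_inj; rewrite /= rmorphD mulrDl. Qed.

HB.instance Definition _ n := GRing.Zmodule_isLmodule.Build R (homog n)
  (@homog_scaleA n) (@homog_scale1 n) (@homog_scaleDr n) (@homog_scaleDl n).

Lemma gpiece1 : 1 \in gpiece A 0%N.
Proof. by rewrite -(rmorph1 (gstruct A)) gpiece_struct. Qed.

Definition homog_one : homog 0%N := Homog gpiece1.

Lemma homog_one_bij : bijective (fun r : R => r *: homog_one).
Proof.
have valE r : homog_val (r *: homog_one) = gstruct A r by rewrite /= mulr1.
have exr (x : homog 0%N) : exists r, r *: homog_one == x.
  have [r xr] := (gpiece0P A (homog_val x)).1 (homogP x).
  by exists r; apply/eqP/val_inj; rewrite /= mulr1.
exists (fun x => xchoose (exr x)) => [r|x]; last exact: eqP (xchooseP (exr x)).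
by apply: (gstruct_inj A); rewrite -!valE (eqP (xchooseP (exr _))).
Qed.

Lemma homog_mul_subproof i j k (e : (i + j)%N = k) (x : homog i) (y : homog j) :
  homog_val x * homog_val y \in gpiece A k.
Proof. by rewrite -e gpiece_mul // homogP. Qed.

Definition homog_mul i j k (e : (i + j)%N = k) (x : homog i) (y : homog j) :
  homog k := Homog (homog_mul_subproof e x y).

End Homogeneous.

(* In a partial algebra, the multiplication m_ij takes its values in degree k *)
(* for any k provably equal to i + j; this avoids transports in the laws.     *)
(* A_0 = R is the statement that r |-> r *: 1 is an isomorphism from R to A_0 *)
(* and that 1 acts as the identity, i.e. m_0i is the scalar multiplication.   *)
Record partialAlg (R : comPzRingType) := PartialAlg {
  psupp : pred nat;
  psupp0 : psupp 0%N;
  pmod : forall i, psupp i -> lmodType R;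
  pone : pmod psupp0;
  pmul : forall (i j k : nat) (hi : psupp i) (hj : psupp j) (hk : psupp k),
    (i + j)%N = k -> pmod hi -> pmod hj -> pmod hk;
  pone_bij : bijective (fun r : R => r *: pone);
  pmul_linearr : forall i j k (hi : psupp i) (hj : psupp j) (hk : psupp k)
      (e : (i + j)%N = k) (x : pmod hi),
    linear (fun y : pmod hj => pmul hk e x y);
  pmul_linearl : forall i j k (hi : psupp i) (hj : psupp j) (hk : psupp k)
      (e : (i + j)%N = k) (y : pmod hj),
    linear (fun x : pmod hi => pmul hk e x y);
  pmul1 : forall i (hi : psupp i) (e : (0 + i)%N = i) (x : pmod hi),
    pmul hi e pone x = x;
  pmulC : forall i j k (hi : psupp i) (hj : psupp j) (hk : psupp k)
      (e : (i + j)%N = k) (e' : (j + i)%N = k) (x : pmod hi) (y : pmod hj),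
    pmul hk e x y = pmul hk e' y x;
  pmulA : forall i j k ij jk ijk (hi : psupp i) (hj : psupp j) (hk : psupp k)
      (hij : psupp ij) (hjk : psupp jk) (hijk : psupp ijk)
      (e1 : (i + j)%N = ij) (e2 : (ij + k)%N = ijk)
      (e3 : (j + k)%N = jk) (e4 : (i + jk)%N = ijk)
      (x : pmod hi) (y : pmod hj) (z : pmod hk),
    pmul hijk e2 (pmul hij e1 x y) z = pmul hijk e4 x (pmul hjk e3 y z)
}.

Arguments psupp {R} p i : rename.
Arguments psupp0 {R} p : rename.
Arguments pone {R} p : rename.
Arguments pmul {R p i j k hi hj} hk e x y : rename.

Record partialHom (R : comPzRingType) (A B : partialAlg R) := PartialHom {
  phom : forall i (hA : psupp A i) (hB : psupp B i), pmod hA -> pmod hB;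
  phom_linear : forall i (hA : psupp A i) (hB : psupp B i),
    linear (@phom i hA hB);
  phom0 : forall r : R, @phom 0%N (psupp0 A) (psupp0 B) (r *: pone A) =
    r *: pone B;
  phom_mul : forall i j k
      (hAi : psupp A i) (hAj : psupp A j) (hAk : psupp A k)
      (hBi : psupp B i) (hBj : psupp B j) (hBk : psupp B k)
      (e : (i + j)%N = k) (x : pmod hAi) (y : pmod hAj),
    @phom k hAk hBk (pmul hAk e x y) =
    pmul hBk e (@phom i hAi hBi x) (@phom j hAj hBj y)
}.

Definition restrict_support (R : comPzRingType) (A : gradedAlg R)
  (I : pred nat) (I0 : I 0%N) : partialAlg R.
Proof.
refine (@PartialAlg R I I0 (fun i _ => homog A i : lmodType R) (homog_one A)
  (fun i j k _ _ _ e x y => homog_mul e x y) (homog_one_bij A) _ _ _ _ _).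
- move=> i j k _ _ _ e x a y z; apply: val_inj.
  by rewrite /= mulrDr mulrCA.
- move=> i j k _ _ _ e y a x z; apply: val_inj.
  by rewrite /= mulrDl mulrA.
- by move=> i _ e x; apply: val_inj; rewrite /= mul1r.
- by move=> i j k _ _ _ e e' x y; apply: val_inj; rewrite /= mulrC.
- move=> i j k ij jk ijk _ _ _ _ _ _ e1 e2 e3 e4 x y z; apply: val_inj.
  by rewrite /= mulrA.
Defined.

Definition graded_to_partial (R : comPzRingType) (A : gradedAlg R) :
  partialAlg R := @restrict_support R A predT isT.

Definition truncation (R : comPzRingType) (A : gradedAlg R) (t : nat) :
  partialAlg R := @restrict_support R A (fun i => i <= t)%N (leq0n t).

Definition gradedHom_homog (R : comPzRingType) (A B : gradedAlg R)
  (f : gradedHom A B) (n : nat) (x : homog A n) : homog B n :=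
  Homog (ghom_piece f (homogP x)).

Definition gradedHom_restrict (R : comPzRingType) (A : gradedAlg R) (t : nat)
  (B : gradedAlg R) (f : gradedHom A B) :
  partialHom (truncation A t) (graded_to_partial B).
Proof.
refine (@PartialHom R (truncation A t) (graded_to_partial B)
  (fun i _ _ => @gradedHom_homog R A B f i) _ _ _).
- move=> i hA hB a x y; apply: val_inj.
  by rewrite /= rmorphD rmorphM ghom_struct.
- by move=> r; apply: val_inj; rewrite /= rmorphM rmorph1 ghom_struct.
- by move=> i j k hAi hAj hAk hBi hBj hBk e x y; apply: val_inj; rewrite /= rmorphM.
Defined.

Definition is_pgg (R : comPzRingType) (t : nat) (A : gradedAlg R) : Prop :=
  (1 <= t)%N /\
  forall B : gradedAlg R, bijective (@gradedHom_restrict R A t B).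

(* Main.v *)
Require Import Defs.
From HB Require Import structures.
From mathcomp Require Import all_boot all_algebra.
From mathcomp Require Import finmap.
From mathcomp.multinomials Require Import monalg.
From mathcomp.classical Require Import boolp.

(* Let phi : R[X_1, ..., X_n] -> A be a presentation with relations f_j, and  *)
(* write phi(X_i) as a sum of homogeneous elements x_(i,d).  A morphism g     *)
(* from the truncation A_(<= t) to B gives psi : R[X_1, ..., X_n] -> B,       *)
(* X_i |-> sum_d g(x_(i,d)).  For each fixed polynomial p and all large t,    *)
(* psi(p) is g applied degree by degree to phi(p).  With p = f_j this shows   *)
(* that psi factors through some h : A -> B; with p a preimage of x_(i,d),    *)
(* that h(x_(i,d)) = g(x_(i,d)).  Only finitely many p occur, so some t works *)
(* for all g.  As A is generated by the x_(i,d), h is graded, extends g, and  *)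
(* is the only such morphism.  No homogeneous presentation of A is needed.    *)

Set Implicit Arguments.
Unset Strict Implicit.
Unset Printing Implicit Defensive.

Import GRing.Theory.

Local Open Scope ring_scope.

(** A morphism g on the part of A in degrees at most t prescribes images for the homogeneous
    components of the finitely many generators, hence a ring morphism psi from the polynomial ring
    to B ([induced_eval]). It reflects g only while computations stay within degree t; but a single
    polynomial p arises by finitely many operations, so beyond a threshold depending on p alone,
    psi(p) is g applied to the terms of a homogeneous decomposition of phi(p)
    ([induced_eval_homogs]).

    Finite presentation leaves finitely many p to control: the relations, so that psi descends to h
    on A, and one preimage of each generator component, so that h and g agree there
    ([induced_eval_bound]). Agreement spreads along sums and products, making h graded and an
    extension of g ([truncated_morphism_extends]). It is the only one, because the generator
    components generate A ([gradedHom_determined]). *)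

(** * Polynomial rings: induction and evaluation *)

Definition polyring_var (R : comPzRingType) (n : nat) (i : 'I_n) :
  polyring R n := << 1 *g ucm i >>.

Lemma cmonom_prodE (I : finType) (k : {cmonom I}) :
  k = \big[mmul/mone]_(i : I) iter (k i) (mmul (ucm i)) mone.
Proof.
have iterE i a j : iter a (mmul (ucm i)) mone j = (a * (i == j))%N.
  by elim: a => [|a IHa] /=; rewrite ?cm1 // cmM cmU IHa mulSn.
apply/eqP/cmP => j.
rewrite (big_morph (fun m : {cmonom I} => m j) (cmM j) (cm1 j)).
rewrite (bigD1 j) //= iterE eqxx muln1 big1 ?addn0 // => i /negbTE neq_ij.
by rewrite iterE neq_ij muln0.
Qed.

Lemma polyring_ind (R : comPzRingType) (n : nat) (P : polyring R n -> Prop) :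
  (forall c, P (polyring_const n c)) -> (forall i, P (polyring_var R i)) ->
  (forall p q, P p -> P q -> P (p + q)) ->
  (forall p q, P p -> P q -> P (p * q)) -> forall p, P p.
Proof.
move=> Pconst Pvar Padd Pmul p.
have Pmon (k : {cmonom 'I_n}) : P << 1 *g k >>.
  have PM (k1 k2 : {cmonom 'I_n}) :
      P << 1 *g k1 >> -> P << 1 *g k2 >> -> P << 1 *g mmul k1 k2 >>.
    move=> P1 P2; suff <- : (<< 1 *g k1 >> : polyring R n) * << 1 *g k2 >> =
        << 1 *g mmul k1 k2 >> by apply: Pmul.
    by rewrite [LHS](monoid_alg_mulUU 1 1 k1 k2) mul1r.
  rewrite [k]cmonom_prodE.
  apply: (big_ind (fun m : {cmonom 'I_n} => P << 1 *g m >>)).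
  - exact: Pconst.
  - exact: PM.
  move=> i _; elim: (k i) => [|a IHa] /=; first exact: Pconst.
  exact: PM (Pvar i) IHa.
rewrite [p]monalgE; apply: (big_ind P) => // [|k _].
  (* The empty sum is covered as the constant 0. *)
  by have := Pconst 0; rewrite /polyring_const monalgU0.
suff <- : polyring_const n p@_k * (<< 1 *g k >> : polyring R n) =
    << p@_k *g k >> by apply: Pmul.
by rewrite [LHS](monoid_alg_mulUU p@_k 1 mone k) mulr1 mul1m.
Qed.

Section PolyringEval.
Variables (R S : comPzRingType) (alpha : {rmorphism R -> S}).
Variables (n : nat) (b : 'I_n -> S).

Definition cmonom_eval (k : {cmonom 'I_n}) : S := \prod_(i < n) b i ^+ k i.

Lemma cmonom_eval1 : cmonom_eval mone = 1.
Proof. by rewrite /cmonom_eval big1 // => i _; rewrite cm1. Qed.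

Lemma cmonom_evalM k l : cmonom_eval (mmul k l) = cmonom_eval k * cmonom_eval l.
Proof.
by rewrite -big_split; apply/eq_bigr => i _ /=; rewrite cmM exprD.
Qed.

Lemma cmonom_evalU i : cmonom_eval (ucm i) = b i.
Proof.
rewrite /cmonom_eval (bigD1 i) //= cmUU expr1 big1 ?mulr1 // => j.
by rewrite eq_sym => /negbTE neq_ij; rewrite cmU neq_ij.
Qed.

Definition polyring_eval (p : polyring R n) : S :=
  \sum_(k <- msupp p) alpha p@_k * cmonom_eval k.

Lemma polyring_evalEw (d : {fset {cmonom 'I_n}}) (p : polyring R n) :
  (msupp p `<=` d)%fset ->
  polyring_eval p = \sum_(k <- d) alpha p@_k * cmonom_eval k.
Proof.
move=> le_d; rewrite /polyring_eval (big_fset_incl _ le_d) // => k _.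
by move=> /mcoeff_outdom ->; rewrite rmorph0 mul0r.
Qed.

Lemma polyring_evalU c k : polyring_eval << c *g k >> = alpha c * cmonom_eval k.
Proof. by rewrite (polyring_evalEw msuppU_le) big_seq_fset1 mcoeffUU. Qed.

Lemma polyring_evalD : {morph polyring_eval : p q / p + q}.
Proof.
move=> p q; rewrite (polyring_evalEw (msuppD_le p q)).
rewrite (polyring_evalEw (fsubsetUl _ (msupp q))).
rewrite (polyring_evalEw (fsubsetUr (msupp p) _)).
rewrite -big_split; apply/eq_bigr => k _ /=.
by rewrite mcoeffD rmorphD mulrDl.
Qed.

Lemma polyring_eval0 : polyring_eval 0 = 0.
Proof. by rewrite /polyring_eval msupp0 big_seq_fset0. Qed.

Lemma polyring_evalM : {morph polyring_eval : p q / p * q}.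
Proof.
move=> p q.
have sumE I (r : seq I) F :
    polyring_eval (\sum_(i <- r) F i) = \sum_(i <- r) polyring_eval (F i).
  exact: (big_morph _ polyring_evalD polyring_eval0).
rewrite [p * q]/(monoid_alg_mul p q) /monoid_alg_mul sumE mulr_suml.
apply/eq_bigr => k _; rewrite sumE mulr_sumr; apply/eq_bigr => l _.
by rewrite polyring_evalU rmorphM cmonom_evalM mulrACA.
Qed.

Lemma polyring_eval1 : polyring_eval 1 = 1.
Proof. by rewrite polyring_evalU rmorph1 cmonom_eval1 mulr1. Qed.

HB.instance Definition _ := GRing.isNmodMorphism.Build (polyring R n) S
  polyring_eval (polyring_eval0, polyring_evalD).

HB.instance Definition _ := GRing.isMonoidMorphism.Build (polyring R n) S
  polyring_eval (polyring_eval1, polyring_evalM).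

Lemma polyring_eval_const c : polyring_eval (polyring_const n c) = alpha c.
Proof. by rewrite polyring_evalU cmonom_eval1 mulr1. Qed.

Lemma polyring_eval_var i : polyring_eval (polyring_var R i) = b i.
Proof. by rewrite polyring_evalU rmorph1 mul1r cmonom_evalU. Qed.

End PolyringEval.

(** * Quotients and common thresholds *)

Lemma rmorphism_factor (P A B : comPzRingType) (phi : {rmorphism P -> A})
    (psi : {rmorphism P -> B}) :
  (forall a, exists p, phi p = a) -> (forall p, phi p = 0 -> psi p = 0) ->
  exists h : {rmorphism A -> B}, forall p, h (phi p) = psi p.
Proof.
move=> phi_surj ker_sub.
have surj a : exists p, phi p == a by have [p <-] := phi_surj a; exists p.
pose h a := psi (xchoose (surj a)).
have hE p : h (phi p) = psi p.
  apply/eqP; rewrite -subr_eq0 -rmorphB; apply/eqP/ker_sub.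
  by rewrite rmorphB (eqP (xchooseP (surj (phi p)))) subrr.
have h_nmod : nmod_morphism h.
  split=> [|a b]; first by rewrite -(rmorph0 phi) hE rmorph0.
  have [[p <-] [q <-]] := (phi_surj a, phi_surj b).
  by rewrite -rmorphD !hE rmorphD.
have h_monoid : monoid_morphism h.
  split=> [|a b]; first by rewrite -(rmorph1 phi) hE rmorph1.
  have [[p <-] [q <-]] := (phi_surj a, phi_surj b).
  by rewrite -rmorphM !hE rmorphM.
pose hN := GRing.isNmodMorphism.Build A B h h_nmod.
pose hM := GRing.isMonoidMorphism.Build A B h h_monoid.
by exists (HB.pack_for {rmorphism A -> B} h hN hM).
Qed.

(** Statements true for all large t are closed under finite conjunction; this is where finiteness of
    the presentation enters. *)
Lemma seq_bound (T : eqType) (Q : T -> nat -> Prop) (s : seq T) :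
  (forall y, y \in s -> exists N, forall t, (N <= t)%N -> Q y t) ->
  exists N, forall t, (N <= t)%N -> forall y, y \in s -> Q y t.
Proof.
elim: s => [|y s IHs] Qs; first by exists 0%N.
have [N1 QN1] := Qs y (mem_head y s).
have [z zs|N2 QN2] := IHs; first by apply: Qs; rewrite inE zs orbT.
exists (N1 + N2)%N => t le_t z; rewrite inE => /predU1P[->|zs].
  exact: QN1 (leq_trans (leq_addr _ _) le_t).
exact: QN2 (leq_trans (leq_addl _ _) le_t) _ zs.
Qed.

Lemma sum_by_degree (T : Type) (V : nmodType) N (s : seq (nat * T))
    (F : nat * T -> V) :
  all (fun y => y.1 < N)%N s ->
  \sum_(y <- s) F y = \sum_(n < N) \sum_(y <- s | y.1 == n) F y.
Proof.
elim: s => [|y s IHs] /=.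
  by rewrite big_nil big1 // => n _; rewrite big_nil.
case/andP=> lt_yN /IHs IH; rewrite big_cons IH (bigD1 (Ordinal lt_yN)) //=.
rewrite [RHS](bigD1 (Ordinal lt_yN)) //= big_cons eqxx addrA; congr (_ + _).
by apply/eq_bigr => n; rewrite -val_eqE /= eq_sym big_cons => /negbTE ->.
Qed.

(** * Homogeneous decompositions in a graded algebra *)

Section HomogeneousSums.
Variables (R : comPzRingType) (A : gradedAlg R).

(* Elements of A are handled through lists of pairs (degree, homogeneous      *)
(* element), several of which may have the same degree.                       *)
Definition homogs (s : seq (nat * A)) := all (fun y => y.2 \in gpiece A y.1) s.

Lemma homogs_span a : exists2 s, homogs s & a = \sum_(y <- s) y.2.
Proof.
have [N [c [cA ->]]] := gpiece_span a.
exists [seq (n, c n) | n <- iota 0 N].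
  by apply/allP => _ /mapP[n _ ->] /=.
by rewrite big_map -(big_mkord xpredT c) /index_iota subn0.
Qed.

Lemma homogs_sum_piece s k :
  homogs s -> \sum_(y <- s | y.1 == k) y.2 \in gpiece A k.
Proof.
move=> /allP sA; rewrite big_seq_cond; apply: rpred_sum => y /andP[ys /eqP <-].
exact: sA.
Qed.

(** Uniqueness of homogeneous components: the differences [c i] are homogeneous and sum to zero, so
    directness of the grading kills each of them. *)
Lemma homogs_component s k n x :
  homogs s -> x \in gpiece A k -> x = \sum_(y <- s) y.2 ->
  \sum_(y <- s | y.1 == n) y.2 = if n == k then x else 0.
Proof.
(* [N] exceeds every degree in [s] as well as [k] and [n], so a sum over degrees below [N] loses
   nothing. *)
move=> sA xA x_s; pose N := (\max_(y <- s) y.1 + k + n).+1.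
pose c i := \sum_(y <- s | y.1 == i) y.2 - if i == k then x else 0.
have cA i : c i \in gpiece A i.
  rewrite rpredB ?homogs_sum_piece //.
  by case: eqP => [->|_]; rewrite ?rpred0.
have lt_sN : all (fun y => y.1 < N)%N s.
  apply/allP => y ys; rewrite ltnS -addnA.
  by apply: leq_trans (leq_addr _ _); apply: leq_bigmax_seq.
have lt_kN : (k < N)%N by rewrite ltnS addnAC leq_addl.
apply/eqP; rewrite -subr_eq0; apply/eqP/(gpiece_direct (N := N) cA); last first.
  by rewrite ltnS leq_addl.
rewrite sumrB -(sum_by_degree (snd : nat * A -> A) lt_sN) -x_s.
rewrite (bigD1 (Ordinal lt_kN)) //= eqxx big1 ?addr0 ?subrr // => i.
by rewrite -val_eqE /= => /negbTE ->.
Qed.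

Definition homogs_mul (s1 s2 : seq (nat * A)) :=
  [seq ((y.1 + z.1)%N, y.2 * z.2) | y <- s1, z <- s2].

Lemma homogs_mulP s1 s2 : homogs s1 -> homogs s2 -> homogs (homogs_mul s1 s2).
Proof.
move=> /allP s1A /allP s2A; apply/allP => _ /allpairsP[[y z] [/= ys zs ->]] /=.
exact: gpiece_mul (s1A y ys) (s2A z zs).
Qed.

Lemma homogs_mul_sum (V : nmodType) s1 s2 (F : nat * A -> V) :
  \sum_(y <- homogs_mul s1 s2) F y =
  \sum_(y <- s1) \sum_(z <- s2) F ((y.1 + z.1)%N, y.2 * z.2).
Proof. exact: big_allpairs_dep. Qed.

End HomogeneousSums.

(** * Morphisms defined up to degree t *)

Section PartialMorphism.
Variables (R : comPzRingType) (A B : gradedAlg R).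

(** Partial morphisms as total functions, free of dependent types: only the values on homogeneous
    elements of degree at most t are constrained. Linearity over R is additivity plus the case
    [i = 0] of [tm_mul], by [tm_struct]. *)
Record truncated_morphism (t : nat) (G : nat -> A -> B) : Prop := {
  tm_piece : forall k x, (k <= t)%N -> x \in gpiece A k -> G k x \in gpiece B k;
  tm_add : forall k x y, (k <= t)%N -> x \in gpiece A k -> y \in gpiece A k ->
    G k (x + y) = G k x + G k y;
  tm_struct : forall r, G 0%N (gstruct A r) = gstruct B r;
  tm_mul : forall i j x y, (i + j <= t)%N -> x \in gpiece A i ->
    y \in gpiece A j -> G (i + j)%N (x * y) = G i x * G j y
}.

Variables (t : nat) (G : nat -> A -> B).
Hypothesis GP : truncated_morphism t G.

Lemma tm_0 k : (k <= t)%N -> G k 0 = 0.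
Proof.
move=> kt; apply: (addrI (G k 0)).
by rewrite -(tm_add GP) ?rpred0 // !addr0.
Qed.

Lemma tm_sum_degree s k : (k <= t)%N -> homogs s ->
  G k (\sum_(y <- s | y.1 == k) y.2) = \sum_(y <- s | y.1 == k) G y.1 y.2.
Proof.
move=> kt; elim: s => [|y s IHs] /=; first by rewrite !big_nil tm_0.
case/andP=> yA sA; rewrite !big_cons; case: eqP => [yk|_]; last exact: IHs.
have yA' : y.2 \in gpiece A k by rewrite -yk.
by rewrite (tm_add GP) ?homogs_sum_piece ?IHs ?yk.
Qed.

(** Terms of degree other than [k] cancel in A, and additivity in each degree carries the
    cancellation over to B. *)
Lemma tm_sum s k x :
  homogs s -> all (fun y => y.1 <= t)%N s -> (k <= t)%N -> x \in gpiece A k ->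
  x = \sum_(y <- s) y.2 -> \sum_(y <- s) G y.1 y.2 = G k x.
Proof.
move=> sA st kt xA x_s.
rewrite (sum_by_degree (N := t.+1) (fun y => G y.1 y.2) st).
have kt' : (k < t.+1)%N by [].
rewrite (bigD1 (Ordinal kt')) //= -tm_sum_degree // (homogs_component k sA xA) //.
rewrite eqxx big1 ?addr0 // => i; rewrite -val_eqE /= => /negbTE neq_ik.
have it : (i <= t)%N by rewrite -ltnS.
by rewrite -tm_sum_degree // (homogs_component _ sA xA) // neq_ik tm_0.
Qed.

End PartialMorphism.

(** * Extending truncated morphisms along a presentation *)

Section Presentation.
Variables (R : comPzRingType) (A : gradedAlg R) (n : nat).
Variable phi : {rmorphism polyring R n -> A}.
Hypothesis phi_const : forall c, phi (polyring_const n c) = gstruct A c.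
Variable xs : 'I_n -> seq (nat * A).
Hypothesis xs_homog : forall i, homogs (xs i).
Hypothesis phi_var : forall i, phi (polyring_var R i) = \sum_(y <- xs i) y.2.

Definition induced_eval (B : gradedAlg R) (G : nat -> A -> B) :
    {rmorphism polyring R n -> B} :=
  polyring_eval (gstruct B) (fun i => \sum_(y <- xs i) G y.1 y.2).

(** The order of quantifiers is the point: [s] and [N] depend on [p] alone and serve every B, t and
    G at once. *)
Lemma induced_eval_homogs p : exists s N,
  [/\ homogs s, all (fun y => y.1 <= N)%N s, phi p = \sum_(y <- s) y.2
    & forall (B : gradedAlg R) t (G : nat -> A -> B),
        truncated_morphism t G -> (N <= t)%N ->
        induced_eval G p = \sum_(y <- s) G y.1 y.2].
Proof.
elim/polyring_ind: p => [c|i|p q|p q].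
- exists [:: (0%N, gstruct A c)], 0%N.
  rewrite /homogs /= gpiece_struct big_seq1 phi_const; split=> // B t G GP _.
  by rewrite big_seq1 (tm_struct GP) polyring_eval_const.
- exists (xs i), (\max_(y <- xs i) y.1); split=> // [|B t G _ _].
    by apply/allP => y ys; apply: leq_bigmax_seq.
  exact: polyring_eval_var.
- move=> [s1 [N1 [s1A s1N p_s1 IH1]]] [s2 [N2 [s2A s2N p_s2 IH2]]].
  exists (s1 ++ s2), (N1 + N2)%N; split.
  + by rewrite /homogs all_cat; apply/andP.
  + rewrite all_cat; apply/andP; split; [move: s1N | move: s2N]; apply: sub_all.
      by move=> y yN; apply: leq_trans yN (leq_addr _ _).
    by move=> y yN; apply: leq_trans yN (leq_addl _ _).
  + by rewrite rmorphD big_cat p_s1 p_s2.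
  move=> B t G GP le_t.
  have N1t : (N1 <= t)%N := leq_trans (leq_addr _ _) le_t.
  have N2t : (N2 <= t)%N := leq_trans (leq_addl _ _) le_t.
  by rewrite rmorphD big_cat (IH1 _ _ _ GP N1t) (IH2 _ _ _ GP N2t).
- move=> [s1 [N1 [s1A s1N p_s1 IH1]]] [s2 [N2 [s2A s2N p_s2 IH2]]].
  (* Degrees add, so with [N1 + N2] as bound every product of entries stays where G is
     multiplicative. *)
  exists (homogs_mul s1 s2), (N1 + N2)%N; split.
  + exact: homogs_mulP.
  + apply/allP => _ /allpairsP[[y z] [/= ys zs ->]] /=.
    exact: leq_add (allP s1N y ys) (allP s2N z zs).
  + by rewrite rmorphM p_s1 p_s2 homogs_mul_sum big_distrlr.
  move=> B t G GP le_t.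
  have N1t : (N1 <= t)%N := leq_trans (leq_addr _ _) le_t.
  have N2t : (N2 <= t)%N := leq_trans (leq_addl _ _) le_t.
  rewrite rmorphM homogs_mul_sum (IH1 _ _ _ GP N1t) (IH2 _ _ _ GP N2t).
  rewrite big_distrlr /=; apply/eq_big_seq => y ys.
  apply/eq_big_seq => z zs.
  rewrite (tm_mul GP _ (allP s1A y ys) (allP s2A z zs)) //.
  exact: leq_trans (leq_add (allP s1N y ys) (allP s2N z zs)) le_t.
Qed.

Lemma induced_eval_piece k x q :
  x \in gpiece A k -> phi q = x -> exists N, forall t, (N <= t)%N ->
  (k <= t)%N /\ forall (B : gradedAlg R) (G : nat -> A -> B),
    truncated_morphism t G -> induced_eval G q = G k x.
Proof.
move=> xA qx; have [s [N [sA sN q_s sE]]] := induced_eval_homogs q.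
exists (N + k)%N => t le_t.
have kt : (k <= t)%N := leq_trans (leq_addl _ _) le_t.
have Nt : (N <= t)%N := leq_trans (leq_addr _ _) le_t.
split=> // B G GP; rewrite (sE _ _ _ GP Nt).
apply: (tm_sum GP) => //; last by rewrite -qx.
by apply: sub_all sN => y yN; apply: leq_trans yN Nt.
Qed.

Hypothesis phi_surj : forall x, exists p, phi p = x.
Variables (m : nat) (f : 'I_m -> polyring R n).
Hypothesis phi_ker : forall p,
  phi p = 0 <-> exists g : 'I_m -> polyring R n, p = \sum_(j < m) g j * f j.

Lemma induced_eval_bound : exists N, forall t, (N <= t)%N ->
  (forall i y, y \in xs i -> (y.1 <= t)%N) /\
  forall (B : gradedAlg R) (G : nat -> A -> B), truncated_morphism t G ->
    (forall j, induced_eval G (f j) = 0) /\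
    (forall i y, y \in xs i ->
       exists2 q, phi q = y.2 & induced_eval G q = G y.1 y.2).
Proof.
have [j _|N1 N1P] := @seq_bound 'I_m (fun j t =>
    forall (B : gradedAlg R) (G : nat -> A -> B),
      truncated_morphism t G -> induced_eval G (f j) = 0) (enum 'I_m).
  have fj0 : phi (f j) = 0.
    apply/phi_ker; exists (fun i => (i == j)%:R).
    rewrite (bigD1 j) //= eqxx mul1r big1 ?addr0 // => i /negbTE ->.
    by rewrite mul0r.
  (* Zero is homogeneous of every degree; viewed in degree 0, it gives the value [G 0 0], which
     vanishes. *)
  have [N NP] := induced_eval_piece (rpred0 (gpiece A 0%N)) fj0.
  exists N => t /NP[_ tP] B G GP; rewrite tP //; exact: tm_0 GP _ _.
have [y _|N2 N2P] := @seq_bound _ (fun y t => y.2 \in gpiece A y.1 ->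
    (y.1 <= t)%N /\
    exists2 q, phi q = y.2 & forall (B : gradedAlg R) (G : nat -> A -> B),
      truncated_morphism t G -> induced_eval G q = G y.1 y.2)
    (flatten (codom xs)).
  case: (boolP (y.2 \in gpiece A y.1)) => [yA|/negP yA]; last by exists 0%N.
  have [q qy] := phi_surj y.2.
  have [N NP] := induced_eval_piece yA qy.
  by exists N => t /NP[yt tP] _; split=> //; exists q.
exists (N1 + N2)%N => t le_t.
have N1t : (N1 <= t)%N := leq_trans (leq_addr _ _) le_t.
have N2t : (N2 <= t)%N := leq_trans (leq_addl _ _) le_t.
have yP i y (yx : y \in xs i) : (y.1 <= t)%N /\
    exists2 q, phi q = y.2 & forall (B : gradedAlg R) (G : nat -> A -> B),
      truncated_morphism t G -> induced_eval G q = G y.1 y.2.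
  apply: N2P => //; last exact: allP (xs_homog i) y yx.
  by apply/flattenP; exists (xs i) => //; apply: codom_f.
split=> [i y yx|B G GP]; first exact: (yP i y yx).1.
split=> [j|i y yx]; first by apply: (N1P t N1t j _ B G GP); rewrite mem_enum.
by have [_ [q qy qP]] := yP i y yx; exists q; last exact: qP.
Qed.

Lemma truncated_morphism_extends : exists N, forall t, (N <= t)%N ->
  forall (B : gradedAlg R) (G : nat -> A -> B), truncated_morphism t G ->
  exists h : gradedHom A B,
    forall k x, (k <= t)%N -> x \in gpiece A k -> h x = G k x.
Proof.
have [N NP] := induced_eval_bound; exists N => t /NP[xst tP] B G GP.
have [f0 lift] := tP B G GP.
have [|h hE] := rmorphism_factor (psi := induced_eval G) phi_surj.
  move=> p /phi_ker[g ->]; rewrite rmorph_sum big1 // => j _.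
  by rewrite rmorphM f0 mulr0.
have h_struct r : h (gstruct A r) = gstruct B r.
  by rewrite -phi_const hE; apply: polyring_eval_const.
(* Products of good entries may leave the range of G; then only compatibility of h with degrees is
   claimed, which keeps goodness closed under products. *)
pose good y := [&& y.2 \in gpiece A y.1, h y.2 \in gpiece B y.1
  & (y.1 <= t)%N ==> (h y.2 == G y.1 y.2)].
have goods a : exists2 s, all good s & a = \sum_(y <- s) y.2.
  have [p <-] := phi_surj a; elim/polyring_ind: p => [c|i|p q|p q].
  - exists [:: (0%N, gstruct A c)]; last by rewrite big_seq1 phi_const.
    rewrite /= /good /= h_struct (tm_struct GP) eqxx.
    by rewrite (gpiece_struct A) (gpiece_struct B).
  - exists (xs i) => //; apply/allP => y yx.
    have yA := allP (xs_homog i) y yx; have yt := xst i y yx.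
    (* [y.2] is just one component of phi(X_i), so the value of h on it is read off a preimage of
       its own. *)
    have [q qy qG] := lift i y yx.
    have hy : h y.2 = G y.1 y.2 by rewrite -{1}qy hE qG.
    by rewrite /good yA hy (tm_piece GP) ?eqxx ?implybT.
  - move=> [s1 s1P p_s1] [s2 s2P q_s2]; exists (s1 ++ s2).
      by rewrite all_cat s1P.
    by rewrite rmorphD big_cat p_s1 q_s2.
  - move=> [s1 s1P p_s1] [s2 s2P q_s2]; exists (homogs_mul s1 s2); last first.
      by rewrite rmorphM p_s1 q_s2 homogs_mul_sum big_distrlr.
    apply/allP => _ /allpairsP[[y z] [/= /(allP s1P) yP /(allP s2P) zP ->]].
    case/and3P: yP => yA yB yG; case/and3P: zP => zA zB zG.
    rewrite /good /= gpiece_mul // rmorphM gpiece_mul //=.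
    apply/implyP => yzt; rewrite (tm_mul GP) //.
    have yt := leq_trans (leq_addr _ _) yzt.
    have zt := leq_trans (leq_addl _ _) yzt.
    by rewrite (eqP (implyP yG yt)) (eqP (implyP zG zt)).
have hP k x : x \in gpiece A k ->
    h x \in gpiece B k /\ ((k <= t)%N -> h x = G k x).
  move=> xA; have [s s_good x_s] := goods x.
  have sA : homogs s by apply: sub_all s_good => y /and3P[].
  (* A homogeneous [x] is the sum of the degree [k] entries of its good list, so both claims reduce
     to these entries. *)
  have := homogs_component k sA xA x_s; rewrite eqxx => <-.
  rewrite rmorph_sum big_seq_cond; split.
    apply: rpred_sum => y /andP[/(allP s_good) /and3P[_ yB _] /eqP <-].
    exact: yB.
  move=> kt; rewrite (tm_sum_degree GP) // [RHS]big_seq_cond.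
  apply: eq_bigr => y /andP[/(allP s_good) /and3P[_ _ /implyP yG] /eqP yk].
  by apply/eqP/yG; rewrite yk.
by exists (GradedHom h_struct (fun k x xA => (hP k x xA).1)) => k x kt /hP[_ ->].
Qed.

(** For large t all generator components have degree at most t, so agreement there is agreement on
    generators. *)
Lemma gradedHom_determined : exists N, forall t, (N <= t)%N ->
  forall (B : gradedAlg R) (h h' : gradedHom A B),
  (forall k x, (k <= t)%N -> x \in gpiece A k -> h x = h' x) -> h =1 h'.
Proof.
have [N NP] := induced_eval_bound; exists N => t /NP[xst _] B h h' eq_h a.
have [p <-] := phi_surj a; elim/polyring_ind: p => [c|i|p q IHp IHq|p q IHp IHq].
- by rewrite phi_const !ghom_struct.
- rewrite phi_var !rmorph_sum; apply/eq_big_seq => y yx /=.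
  exact: eq_h (xst i y yx) (allP (xs_homog i) y yx).
- by rewrite !rmorphD IHp IHq.
by rewrite !rmorphM IHp IHq.
Qed.

End Presentation.

(** * Extensionality of morphisms and passage to total functions *)

Lemma gradedHom_ext (R : comPzRingType) (A B : gradedAlg R)
  (h h' : gradedHom A B) : h =1 h' -> h = h'.
Proof.
case: h h' => [[f [[fA] [fM]]] fS fP] [[f' [[fA'] [fM']]] fS' fP'] /=.
move/funext => eq_f; case: _ / eq_f in fA' fM' fS' fP' *.
rewrite (Prop_irrelevance fA' fA) (Prop_irrelevance fM' fM).
by rewrite (Prop_irrelevance fS' fS) (Prop_irrelevance fP' fP).
Qed.

Lemma partialHom_ext (R : comPzRingType) (A B : partialAlg R)
    (g g' : partialHom A B) :
  (forall i hA hB x, @phom R A B g i hA hB x = @phom R A B g' i hA hB x) ->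
  g = g'.
Proof.
move=> eq_g; have {eq_g} : @phom R A B g = @phom R A B g'.
  by do 3![apply/functional_extensionality_dep => ?]; apply/funext; apply: eq_g.
case: g g' => [f f1 f2 f3] [f' f1' f2' f3'] /= eq_f.
case: _ / eq_f in f1' f2' f3' *.
by rewrite (Prop_irrelevance f1' f1) (Prop_irrelevance f2' f2)
  (Prop_irrelevance f3' f3).
Qed.

Section PartialHomExtension.
Variables (R : comPzRingType) (A B : gradedAlg R) (t : nat).
Variable g : partialHom (truncation A t) (graded_to_partial B).

(** The proofs of [k <= t] and of homogeneity that [phom] demands are recovered by deciding them,
    with default value 0 elsewhere. *)
Definition total_phom (k : nat) (x : A) : B :=
  if pselect (k <= t)%N is left kt then
    if insub x is Some u then
      homog_val (@phom R _ _ g k kt isT u : homog B k) else 0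
  else 0.

Lemma total_phomE k (kt : (k <= t)%N) (u : homog A k) :
  total_phom k (homog_val u) = homog_val (@phom R _ _ g k kt isT u : homog B k).
Proof.
rewrite /total_phom; case: pselect => // kt'.
by rewrite (eq_irrelevance kt' kt) valK.
Qed.

Lemma total_phom_truncated : truncated_morphism t total_phom.
Proof.
split=> [k x kt xA|k x y kt xA yA|r|i j x y ijt xA yA].
- by rewrite (total_phomE kt (Homog xA)) homogP.
- rewrite (total_phomE kt (Homog xA)) (total_phomE kt (Homog yA)).
  rewrite (total_phomE kt (Homog xA + Homog yA)).
  have := @phom_linear R _ _ g k kt isT 1 (Homog xA) (Homog yA).
  by rewrite !scale1r => ->.
- have := phom0 g r => /(congr1 (@homog_val R B 0%N)) /=.
  by rewrite mulr1 => <-; rewrite -total_phomE /= mulr1.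
have it := leq_trans (leq_addr j i) ijt; have jt := leq_trans (leq_addl i j) ijt.
rewrite (total_phomE it (Homog xA)) (total_phomE jt (Homog yA)).
rewrite (total_phomE ijt (homog_mul erefl (Homog xA) (Homog yA))).
have := @phom_mul R _ _ g i j (i + j)%N it jt ijt isT isT isT erefl
  (Homog xA) (Homog yA).
by move=> /(congr1 (@homog_val R B (i + j)%N)).
Qed.

End PartialHomExtension.

Theorem proposition5p9 (R : comPzRingType) (A : gradedAlg R) :
  finitely_presented (gstruct A) ->
  exists t : nat, (0 < t)%N /\ is_pgg t A.
Proof.
move=> [n [m [f [phi [phi_const phi_surj phi_ker]]]]].
have xs_ex (i : 'I_n) : exists s : seq (nat * A),
    homogs s /\ phi (polyring_var R i) = \sum_(y <- s) y.2.
  by have [s sA x_s] := homogs_span (phi (polyring_var R i)); exists s.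
have [xs xsP] := choice xs_ex.
have xs_homog i := (xsP i).1; have phi_var i := (xsP i).2.
have [N1 extends] :=
  truncated_morphism_extends phi_const xs_homog phi_var phi_surj phi_ker.
have [N2 determined] :=
  gradedHom_determined phi_const xs_homog phi_var phi_surj phi_ker.
(* The sum dominates both thresholds; the successor makes t positive. *)
exists (N1 + N2).+1; set t := (N1 + N2).+1; split=> //; split=> // B.
have N1t : (N1 <= t)%N by rewrite /t -addnS leq_addr.
have N2t : (N2 <= t)%N by rewrite /t -addSn leq_addl.
have restr_inj : injective (@gradedHom_restrict R A t B).
  move=> h h' eq_hh'; apply/gradedHom_ext/(determined t N2t) => k x kt xA.
  exact: (congr1 (fun g : partialHom (truncation A t) (graded_to_partial B) =>
    homog_val (@phom R _ _ g k kt isT (Homog xA) : homog B k)) eq_hh').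
have restr_surj g : exists h : gradedHom A B, gradedHom_restrict t h = g.
  have [h hP] := extends t N1t B _ (total_phom_truncated g).
  exists h; apply: partialHom_ext => k kt kB u; apply: val_inj => /=.
  rewrite (hP _ _ kt (homogP u)) (total_phomE g kt).
  by rewrite (eq_irrelevance kB isT).
(* [bijective] asks for an inverse function, obtained by choosing an extension of each g. *)
have [inv invP] := choice restr_surj.
by exists inv => // h; apply: restr_inj; rewrite invP.
Qed.
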